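(* Let $d \ge 1$ and let $A$ and $B$ be finite difference stencils on $\mathbb{R}^d$ (with the same lattice spacing $h$) of derivative orders $\bar a$ and $\bar b$ respectively, where $\bar a, \bar b \in \mathbb{Z}_{\ge 0}^d$ are multi-indices. Then the two compositions agree, $A(B) = B(A)$ (that is, $(A(B)f)(\mathbf{x}) = (B(A)f)(\mathbf{x})$ for every function $f:\mathbb{R}^d\to\mathbb{R}$, every $h>0$ and every $\mathbf{x}\in\mathbb{R}^d$), and the composed stencil $C = A(B) = B(A)$ has derivative order $\bar a + \bar b$.
   Context: A finite difference stencil $A$ on $\mathbb{R}^d$ is given by a finite index set $I$, integer offset vectors $\mathbf{u}_i \in \mathbb{Z}^d$ and weights $a_i \in \mathbb{R}$ ($i \in I$). With lattice spacing $h>0$ it acts on functions $f$ on $\mathbb{R}^d$ by $$(Af)(\mathbf{x}) = \sum_{i\in I} a_i\, f(\mathbf{x}+h\mathbf{u}_i).$$ Multi-index notation is used: $|\alpha| = \alpha_1+\dots+\alpha_d$, $\alpha! = \alpha_1!\cdots\alpha_d!$, $\mathbf{u}^\alpha = u_1^{\alpha_1}\cdots u_d^{\alpha_d}$ with $0^0=1$. Derivative order: $A$ has derivative order $p \in \mathbb{Z}_{\ge 0}^d$ if its weights have the form $a_i = c_i h^{-|p|}$ with $c_i\in\mathbb{R}$ independent of $h$, and, in the formal Taylor expansion $\sum_i a_i f(\mathbf{x}_0+h\mathbf{u}_i) = \sum_{\alpha} \big(\sum_i a_i \mathbf{u}_i^\alpha/\alpha!\big) h^{|\alpha|} f^{(\alpha)}(\mathbf{x}_0)$,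 the coefficient of $f^{(p)}(\mathbf{x}_0)$ equals $1$ and the coefficients of all other derivatives $f^{(\alpha)}(\mathbf{x}_0)$ with $|\alpha|\le |p|$ vanish. Equivalently, $\sum_i c_i \mathbf{u}_i^{p}/p! = 1$ and $\sum_i c_i \mathbf{u}_i^\alpha/\alpha! = 0$ for all $\alpha \ne p$ with $|\alpha| \le |p|$. Composition: if $A$ has offsets $\mathbf{u}_i$ and weights $a_i$ ($i\in I$), and $B$ has offsets $\mathbf{v}_j$ and weights $b_j$ ($j\in J$), then $B(A)$ is the stencil obtained by applying the outer stencil $B$ to the result of applying the inner stencil $A$: $$(B(A)f)(\mathbf{x}) = \sum_{j\in J} b_j \sum_{i\in I} a_i\, f(\mathbf{x}+h(\mathbf{u}_i+\mathbf{v}_j)),$$ i.e. the stencil indexed by $I\times J$ with offsets $\mathbf{u}_i+\mathbf{v}_j$ and weights $a_i b_j$. $A(B)$ is defined likewise with the roles exchanged. *)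

(* Defs.v *)
From mathcomp Require Import all_boot all_order all_algebra.
From mathcomp Require Import reals.
From mathcomp Require Import mpoly.

Set Implicit Arguments.
Unset Strict Implicit.
Unset Printing Implicit Defensive.

Import Order.TTheory GRing.Theory Num.Theory.

Local Open Scope ring_scope.

(* The weights are functions of the lattice spacing h; only their values at
   h > 0 are ever used. The offsets need not be pairwise distinct. *)
Record stencil (R : realType) (d : nat) := Stencil {
  sindex : finType;
  soffset : sindex -> 'rV[int]_d;
  sweight : R -> sindex -> R
}.

Definition sapply (R : realType) (d : nat) (A : stencil R d) (h : R)
    (f : 'rV[R]_d -> R) (x : 'rV[R]_d) : R :=
  \sum_(i : sindex A)
     sweight h i * f (x + h *: map_mx (fun z : int => z%:~R) (soffset i)).

(* [scomp B A] is B(A): B is the outer stencil, A the inner one. *)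
Definition scomp (R : realType) (d : nat) (B A : stencil R d) : stencil R d :=
  @Stencil R d (sindex A * sindex B)%type
    (fun ij => soffset ij.1 + soffset ij.2)
    (fun h ij => sweight h ij.1 * sweight h ij.2).

Lemma scomp_apply (R : realType) (d : nat) (B A : stencil R d) (h : R)
    (f : 'rV[R]_d -> R) (x : 'rV[R]_d) :
  sapply (scomp B A) h f x = sapply B h (sapply A h f) x.
Proof.
rewrite /sapply /=.
under [RHS]eq_bigr do rewrite mulr_sumr.
rewrite exchange_big pair_big /=; apply: eq_bigr => -[i j] _ /=.
rewrite mulrCA mulrA; congr (_ * f _).
by rewrite map_mxD -[RHS]addrA -scalerDr [X in h *: X]addrC.
Qed.

Definition mi_fact (d : nat) (alpha : 'X_{1..d}) : nat :=
  (\prod_(k < d) (alpha k)`!)%N.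

Definition mi_exp (R : realType) (d : nat) (u : 'rV[int]_d)
    (alpha : 'X_{1..d}) : R :=
  \prod_(k < d) ((u ord0 k)%:~R : R) ^+ alpha k.

(* Coefficient of f^(alpha)(x0) in the formal Taylor expansion in h of
   sum_i a_i f(x0 + h u_i). *)
Definition taylor_coef (R : realType) (d : nat) (A : stencil R d) (h : R)
    (alpha : 'X_{1..d}) : R :=
  (\sum_(i : sindex A)
     sweight h i * mi_exp R (soffset i) alpha / (mi_fact alpha)%:R)
  * h ^+ mdeg alpha.

Definition derivative_order (R : realType) (d : nat) (A : stencil R d)
    (p : 'X_{1..d}) : Prop :=
  (exists c : sindex A -> R,
     forall (h : R) (i : sindex A), 0 < h -> sweight h i = c i * h ^- mdeg p)
  /\
  (forall h : R, 0 < h ->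
     taylor_coef A h p = 1 /\
     forall alpha : 'X_{1..d},
       alpha <> p -> (mdeg alpha <= mdeg p)%N -> taylor_coef A h alpha = 0).

(* Main.v *)
Require Import Defs.
From mathcomp Require Import all_boot all_order all_algebra.
From mathcomp Require Import reals.
From mathcomp Require Import mpoly.
From mathcomp Require Import zify ring.

(** The Taylor coefficients of a composed stencil are the convolution of those
    of its factors, by the binomial theorem applied to each coordinate of
    [(u + v)^gamma / gamma!]. When [|gamma| <= |a| + |b|], each term
    [(alpha, gamma - alpha)] of the convolution has [|alpha| < |a|], or
    [|gamma - alpha| < |b|], or equality in both, so it vanishes unless
    [alpha = a] and [gamma - alpha = b]. *)

Import Order.TTheory GRing.Theory Num.Theory.

Local Open Scope ring_scope.

Definition mnm_of_ffun {d n : nat} (s : {ffun 'I_d -> 'I_n}) : 'X_{1..d} :=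
  [multinom (s k : nat) | k < d].

(* The divisors of the monomial [g], coded as functions into a type of
   exponents large enough to contain all of them. *)
Definition mnm_below {d : nat} (g : 'X_{1..d}) :=
  family (fun (k : 'I_d) (j : 'I_(mdeg g).+1) => (j <= g k)%N).

Lemma mnm_belowP (d : nat) (g : 'X_{1..d})
    (s : {ffun 'I_d -> 'I_(mdeg g).+1}) :
  reflect (mnm_of_ffun s <= g)%MM (s \in mnm_below g).
Proof.
apply: (iffP familyP) => [H|/mnm_lepP H k].
  by apply/mnm_lepP => k; rewrite mnmE; exact: H.
by have := H k; rewrite mnmE.
Qed.

Lemma mnm_le_mdeg {d : nat} (g : 'X_{1..d}) (k : 'I_d) : (g k <= mdeg g)%N.
Proof. by rewrite mdegE (bigD1 k) //= leq_addr. Qed.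

(** Dividing by [n!] turns ['C(n, i)] into [1 / (i! (n - i)!)], so the binomial theorem becomes a
    plain convolution. *)
Lemma exprD_fact (F : numFieldType) (x y : F) (n : nat) :
  (x + y) ^+ n / n`!%:R =
  \sum_(i < n.+1) (x ^+ i / i`!%:R) * (y ^+ (n - i) / (n - i)`!%:R).
Proof.
rewrite addrC exprDn mulr_suml; apply: eq_bigr => i _.
have lein : (i <= n)%N by rewrite -ltnS.
have fact0 m : (m`!%:R : F) != 0 by rewrite pnatr_eq0 -lt0n fact_gt0.
rewrite -mulr_natr -(bin_fact lein) !natrM.
have bin0 : ('C(n, i)%:R : F) != 0 by rewrite pnatr_eq0 -lt0n bin_gt0.
by field; rewrite bin0 !fact0.
Qed.

Lemma mi_exp_factE (R : realType) (d : nat) (u : 'rV[int]_d) (g : 'X_{1..d}) :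
  mi_exp R u g / (mi_fact g)%:R =
  \prod_(k < d) ((u ord0 k)%:~R ^+ g k / (g k)`!%:R).
Proof. by rewrite /mi_exp /mi_fact natr_prod prodf_div. Qed.

Lemma mi_expD_fact (R : realType) (d : nat) (u v : 'rV[int]_d)
    (g : 'X_{1..d}) :
  mi_exp R (u + v) g / (mi_fact g)%:R =
  \sum_(s in mnm_below g)
    (mi_exp R u (mnm_of_ffun s) / (mi_fact (mnm_of_ffun s))%:R) *
    (mi_exp R v (g - mnm_of_ffun s)%MM
       / (mi_fact (g - mnm_of_ffun s)%MM)%:R).
Proof.
rewrite mi_exp_factE.
pose t k (i : nat) : R := ((u ord0 k)%:~R ^+ i / i`!%:R) *
  ((v ord0 k)%:~R ^+ (g k - i) / (g k - i)`!%:R).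
(* Widening every coordinate's sum to the common range ['I_(mdeg g).+1] lets the product of sums be
   distributed: the choice functions are exactly the members of [mnm_below g]. *)
transitivity
    (\prod_(k < d) \sum_(j < (mdeg g).+1 | (j <= g k)%N) t k j).
  apply: eq_bigr => k _.
  have le_k : ((g k).+1 <= (mdeg g).+1)%N by rewrite ltnS mnm_le_mdeg.
  by rewrite mxE rmorphD exprD_fact (big_ord_widen _ (t k) le_k).
rewrite bigA_distr_big_dep; apply: eq_bigr => s _.
rewrite !mi_exp_factE -big_split; apply: eq_bigr => k _ /=.
by rewrite mnmBE !mnmE.
Qed.

Lemma taylor_coef_scomp (R : realType) (d : nat) (A B : stencil R d) (h : R)
    (g : 'X_{1..d}) :
  taylor_coef (scomp B A) h g =
  \sum_(s in mnm_below g)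
    taylor_coef A h (mnm_of_ffun s) * taylor_coef B h (g - mnm_of_ffun s)%MM.
Proof.
rewrite /taylor_coef /=.
under eq_bigr do rewrite -mulrA mi_expD_fact mulr_sumr.
rewrite exchange_big mulr_suml; apply: eq_bigr => s /mnm_belowP le_sg.
(* Since [s] lies below [g], the truncated difference is exact and the powers of [h] combine to
   [h ^+ mdeg g]. *)
rewrite [RHS]mulrACA -exprD -mdegD addmC submK //; congr (_ * _).
rewrite big_distrlr /= pair_bigA /=.
by apply: eq_bigr => -[i j] _ /=; rewrite -[in RHS]mulrA mulrACA !mulrA.
Qed.

Lemma derivative_order_coefM (R : realType) (d : nat) (A B : stencil R d)
    (a b p q : 'X_{1..d}) (h : R) :
  derivative_order A a -> derivative_order B b -> 0 < h ->
  (mdeg p + mdeg q <= mdeg a + mdeg b)%N ->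
  taylor_coef A h p * taylor_coef B h q = ((p == a) && (q == b))%:R.
Proof.
move=> [_ hA] [_ hB] h0 le_deg.
have [A1 A0] := hA h h0; have [B1 B0] := hB h h0.
case: (eqVneq p a) => [pa|/eqP pa]; case: (eqVneq q b) => [qb|/eqP qb] /=.
- by rewrite pa qb A1 B1 mulr1.
- by rewrite (B0 q) ?mulr0 //; move: le_deg; rewrite pa leq_add2l.
- by rewrite (A0 p) ?mul0r //; move: le_deg; rewrite qb leq_add2r.
(* If [|p| > |a|], the degree bound forces [|q| < |b|], so the factor from [B] vanishes. *)
- have [le_pa|lt_ap] := leqP (mdeg p) (mdeg a); first by rewrite A0 ?mul0r.
  by rewrite (B0 q) ?mulr0 //; lia.
Qed.

Lemma derivative_order_scomp (R : realType) (d : nat) (A B : stencil R d)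
    (a b : 'X_{1..d}) :
  derivative_order A a -> derivative_order B b ->
  derivative_order (scomp B A) (a + b)%MM.
Proof.
move=> hA hB; split.
  have [[cA cAE] _] := hA; have [[cB cBE] _] := hB.
  exists (fun ij => cA ij.1 * cB ij.2) => h [i j] h0 /=.
  by rewrite cAE // cBE // mdegD exprD invfM mulrACA.
move=> h h0.
(* The coefficient counts the [s] below [g] that split [g] as [a + b]: one if [g] is [a + b], none
   otherwise. *)
have coefE g : (mdeg g <= mdeg (a + b)%MM)%N ->
    taylor_coef (scomp B A) h g =
    \sum_(s in mnm_below g)
      ((mnm_of_ffun s == a) && (g - mnm_of_ffun s == b)%MM)%:R.
  move=> le_g; rewrite taylor_coef_scomp; apply: eq_bigr => s /mnm_belowP le_s.
  apply: derivative_order_coefM => //.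
  by rewrite -!mdegD addmC submK.
split=> [|g neq_g le_g]; rewrite coefE //.
(* Each [a k] is within the range, so [inord] does not fall back to its default. *)
- have fE k : (inord (a k) : 'I_(mdeg (a + b)%MM).+1) = a k :> nat.
    by rewrite inordK // ltnS mdegD (leq_trans (mnm_le_mdeg a k)) ?leq_addr.
  pose s0 : {ffun 'I_d -> 'I_(mdeg (a + b)%MM).+1} := [ffun k => inord (a k)].
  have s0E : mnm_of_ffun s0 = a by apply/mnmP => k; rewrite mnmE ffunE fE.
  have s0_below : s0 \in mnm_below (a + b)%MM.
    by apply/mnm_belowP; rewrite s0E lem_addr.
  have abK : (a + b - a)%MM = b by rewrite addmC addmK.
  rewrite (bigD1 s0) //= s0E abK !eqxx big1 ?addr0 // => s /andP[_ ne].
  (* The coding is injective, so [s0] is the only code of [a]. *)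
  case: eqP => //= sE; case/eqP: ne; apply/ffunP => k; apply: val_inj.
  by have /mnmP/(_ k) := etrans sE (esym s0E); rewrite !mnmE.
- apply: big1 => s /mnm_belowP le_s.
  case: eqP => //= sE; case: eqP => //= gE; case: neq_g.
  by rewrite -(submK le_s) gE sE addmC.
Qed.

(** Swapping the two summation indices suffices, as offsets add and weights multiply
    commutatively. *)
Lemma sapply_scompC (R : realType) (d : nat) (A B : stencil R d) (h : R)
    (f : 'rV[R]_d -> R) (x : 'rV[R]_d) :
  sapply (scomp A B) h f x = sapply (scomp B A) h f x.
Proof.
rewrite /sapply /= -(pair_bigA _ (fun i j => sweight h i * sweight h j *
  f (x + h *: map_mx (fun z : int => z%:~R) (soffset i + soffset j)))) /=.
rewrite exchange_big pair_bigA /=; apply: eq_bigr => -[j i] _ /=.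
by rewrite mulrC [soffset i + _]addrC [sweight h i * _]mulrC mulrC.
Qed.

Theorem lemma2p3 (R : realType) (d : nat) (hd : (0 < d)%N)
    (A B : stencil R d) (a b : 'X_{1..d})
    (hA : derivative_order A a) (hB : derivative_order B b) :
  (forall (f : 'rV[R]_d -> R) (h : R) (x : 'rV[R]_d), 0 < h ->
     sapply (scomp A B) h f x = sapply (scomp B A) h f x) /\
  derivative_order (scomp A B) (a + b)%MM /\
  derivative_order (scomp B A) (a + b)%MM.
Proof.
split; first by move=> f h x _; exact: sapply_scompC.
split; last exact: derivative_order_scomp.
by rewrite addmC; exact: derivative_order_scomp.
Qed.
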